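(* Let $i\geq 3$ and let $G$ be a claw-o-heavy and $Z_i$-c-heavy graph. Then $\mathrm{cl}^{\mathrm c}(G)$ is $Z_i$-free (contains no induced subgraph isomorphic to $Z_i$).
   Context: All graphs are finite and simple. For a graph $G$ on $n=|V(G)|$ vertices, a vertex $v$ is heavy if $d_G(v)\geq n/2$; a pair $\{u,v\}$ is a heavy pair of $G$ if $uv\notin E(G)$ and $d_G(u)+d_G(v)\geq n$. $G$ is claw-o-heavy if every induced $K_{1,3}$ of $G$ contains a heavy pair of $G$. For a graph $S$, $G$ is $S$-c-heavy if for every induced subgraph $G'$ of $G$ isomorphic to $S$ and every maximal clique $C$ of $G'$, every component of $G'-C$ with at least two vertices contains a vertex heavy in $G$. $Z_i$ ($i\geq 1$) is obtained by identifying a vertex of a triangle with an end-vertex of a path on $i+1$ vertices. For $x\in V(G)$, $G'_x$ is obtained from $G$ by adding all missing edges $uv$ with $u,v\in N_G(x)$. For claw-o-heavy $G$ and $x\in V(G)$, let $G^*$ be obtained from $G$ by adding all missing edges $uv$ with $u,v\in N_G(x)$ and $\{u,v\}$ a heavy pair of $G$; $x$ is c-eligible if $N_G(x)$ is not a clique and either $G^*[N_G(x)]$ is connected, or $G^*[N_G(x)]$ consists of two disjoint cliques $C_1,C_2$ and some $z$ with $\{x,z\}$ a heavy pair of $G$ has $zy_1,zy_2\in E(G)$ for some $y_1\in C_1,y_2\in C_2$. The c-closure $\mathrm{cl}^{\mathrm c}(G)$ of a claw-o-heavy graph $G$ is obtained by a sequence $G=G_1,\dots,G_t=\mathrm{cl}^{\mathrm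 c}(G)$ with $G_{j+1}=(G_j)'_{x_j}$ for a c-eligible vertex $x_j$ of $G_j$, where $G_t$ has no c-eligible vertex; it is well defined (Čada). *)

(* Defs.v *)
From Stdlib Require Classical_Prop.
From mathcomp Require Import all_boot.

Set Implicit Arguments.
Unset Strict Implicit.
Unset Printing Implicit Defensive.

Section Graphs.

(* A finite simple graph is a symmetric irreflexive relation [e] on a finType;
   the two properties are hypotheses of the theorem. *)
Variable T : finType.
Implicit Types (e : rel T) (A B C K : {set T}) (x u v z : T).

Definition nbhd e x : {set T} := [set u | e x u].

Definition deg e x : nat := #|nbhd e x|.

Definition heavy e x : bool := #|T| <= 2 * deg e x.

Definition heavy_pair e u v : bool :=
  [&& u != v, ~~ e u v & #|T| <= deg e u + deg e v].

Definition is_clique e C : bool :=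
  [forall u in C, forall v in C, (u != v) ==> e u v].

Definition induced_rel e B : rel T := [rel u v | [&& u \in B, v \in B & e u v]].

Definition induced_connected e B : bool :=
  (B != set0) && [forall u in B, forall v in B, connect (induced_rel e B) u v].

Definition is_component e B K : Prop :=
  exists2 x, x \in B & K = [set u in B | connect (induced_rel e B) x u].

Definition max_clique_in e A C : bool :=
  maxset (fun D : {set T} => (D \subset A) && is_clique e D) C.

Definition induces_copy e (S : finType) (s : rel S) A : Prop :=
  exists f : S -> T,
    [/\ injective f, A = f @: [set: S] & forall a b, e (f a) (f b) = s a b].

Definition graph_free e (S : finType) (s : rel S) : Prop :=
  ~ exists A, induces_copy e s A.

Definition c_heavy e (S : finType) (s : rel S) : Prop :=
  forall A, induces_copy e s A ->
  forall C, max_clique_in e A C ->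
  forall K, is_component e (A :\: C) K -> 2 <= #|K| ->
  exists2 v, v \in K & heavy e v.

(* G'_x *)
Definition local_completion e x : rel T :=
  [rel u v | e u v || [&& u != v, e x u & e x v]].

(* G^* *)
Definition star e x : rel T :=
  [rel u v | e u v || [&& e x u, e x v & heavy_pair e u v]].

Definition two_disjoint_cliques e B C1 C2 : Prop :=
  [/\ B = C1 :|: C2, [disjoint C1 & C2], is_clique e C1, is_clique e C2
    & forall u v, u \in C1 -> v \in C2 -> ~~ e u v].

Definition c_eligible e x : Prop :=
  ~~ is_clique e (nbhd e x) /\
  (induced_connected (star e x) (nbhd e x) \/
   exists C1 C2 : {set T},
     two_disjoint_cliques (star e x) (nbhd e x) C1 C2 /\
     exists z, heavy_pair e x z /\
       exists y1 y2, [/\ y1 \in C1, y2 \in C2, e z y1 & e z y2]).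

Inductive c_reachable : rel T -> rel T -> Prop :=
| c_reach_refl e : c_reachable e e
| c_reach_step e x h :
    c_eligible e x -> c_reachable (local_completion e x) h -> c_reachable e h.

(* [h] is an outcome of the closure procedure started from [e].  By Cada's
   theorem the outcome is unique when [e] is claw-o-heavy. *)
Definition is_c_closure e h : Prop :=
  c_reachable e h /\ forall x, ~ c_eligible h x.

End Graphs.

(* K_{1,3} with centre 0. *)
Definition claw : rel 'I_4 :=
  [rel a b : 'I_4 | (a == 0 :> nat) != (b == 0 :> nat)].

(* Z_i on i+3 vertices: the triangle 0,1,2 and the path 2,3,...,i+2. *)
Definition Z (i : nat) : rel 'I_(i.+3) :=
  [rel a b : 'I_(i.+3) | [|| [&& a != b, a < 3 & b < 3],
                              (2 <= a) && (b == a.+1 :> nat)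
                            | (2 <= b) && (a == b.+1 :> nat)]].
Arguments Z : clear implicits.

Definition claw_o_heavy (T : finType) (e : rel T) : Prop :=
  forall A : {set T}, induces_copy e claw A ->
  exists u v, [/\ u \in A, v \in A & heavy_pair e u v].

Lemma is_c_closure_exists (T : finType) (e : rel T) :
  exists h, is_c_closure e h.
Proof.
apply: Classical_Prop.NNPP.
pose m (f : rel T) := #|[pred p : T * T | ~~ f p.1 p.2]|.
have [n] := ubnP (m e); elim: n e => // n IH e; rewrite ltnS => le_n nh.
apply: (nh); exists e; split; first exact: c_reach_refl.
move=> x elx; apply: (IH (local_completion e x)).
  apply: leq_trans le_n; apply: proper_card; apply/properP; split.
    by apply/subsetP=> -[u v]; rewrite !inE /= negb_or => /andP[].
  case: elx => [/forall_inPn [u ux /forall_inPn[v vx]] + _].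
  rewrite negb_imply => /andP[uv nuv]; exists (u, v); rewrite !inE //=.
  by move: ux vx; rewrite !inE => ux vx; apply/negPn/orP; right; apply/and3P.
by case=> h [rh mh]; apply: nh; exists h; split=> //; apply: c_reach_step rh.
Qed.

(* Main.v *)
Require Import Defs.
From mathcomp Require Import all_boot zify.

(* Let [h] be the closure of [e].  Counting shows that a closed graph has no
   heavy pair, so [h] is claw-free and diamond-free, any two vertices that are
   heavy in [e] are adjacent in [h], and every vertex completed on the way is
   simplicial in [h].

   Suppose [h] contains an induced Z_i with triangle [a b c] and path
   [c = q 0, ..., q i], and let [R] be the maximal clique of [h] through [ab].
   Going back along the closure sequence, the path becomes an induced path of
   [e] leaving [R] at [c], and the triangle becomes a triangle of [e] inside
   the core of [R]: [a], [b], [c] and the simplicial vertices of [R].  Join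
   them by a shortest path in the core.  In the resulting induced Z_i of [e],
   remove the first edge of its path: c-heaviness gives a heavy vertex [t] of
   the triangle and a heavy vertex [y] on the path, not adjacent to [t] in [e].
   Since [t] and [y] are adjacent in [h], [y] lies in the core; counting common
   neighbours of [t] and [y] then puts [y] in a triangle of the core, so the
   connecting path was not shortest. *)

Set Implicit Arguments.
Unset Strict Implicit.
Unset Printing Implicit Defensive.

Lemma leq_card_rel (S T : finType) (A : {set S}) (B : {set T}) (r : S -> T -> bool) :
  {in A, forall x, exists2 y, y \in B & r x y} ->
  {in A & A & B, forall x x' y, r x y -> r x' y -> x = x'} -> #|A| <= #|B|.
Proof.
move=> rAB r_inj; have [->|[x0 x0A]] := set_0Vmem A; first by rewrite cards0.
have [y0 _ _] := rAB x0 x0A; pose f x := odflt y0 [pick y in B | r x y].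
have fP x : x \in A -> (f x \in B) && r x (f x).
  move=> /rAB[y yB xy]; rewrite /f; case: pickP => [//|/(_ y)].
  by rewrite yB xy.
rewrite -(@card_in_imset _ _ f) => [|x x' xA x'A ff].
  by apply/subset_leq_card/subsetP=> _ /imsetP[x /fP/andP[fB _] ->].
have /andP[fB xf] := fP _ xA; have /andP[_ xf'] := fP _ x'A.
by apply: (r_inj _ _ _ xA x'A fB); rewrite // ff.
Qed.

Lemma induced_rel_sym (T : finType) (e : rel T) (B : {set T}) :
  symmetric e -> symmetric (induced_rel e B).
Proof. by move=> e_sym u v; rewrite /induced_rel /= e_sym andbCA. Qed.

Lemma is_cliqueP (T : finType) (e : rel T) (C : {set T}) :
  reflect {in C &, forall u v, u != v -> e u v} (is_clique e C).
Proof.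
apply: (iffP forall_inP) => [clique u v uC vC uv|clique u uC].
  by have /forall_inP/(_ v vC)/implyP := clique u uC; apply.
by apply/forall_inP=> v vC; apply/implyP; apply: clique.
Qed.

Section Adjacency.

Variable T : finType.
Implicit Types (e h : rel T) (u v w x y z : T).

Definition nonadjacent e u v : bool := (u != v) && ~~ e u v.

Definition adj_or_heavy e u v : bool := e u v || heavy_pair e u v.

Definition simplicial e x : bool := is_clique e (nbhd e x).

Definition claw_free e : Prop :=
  forall y u v w, e y u -> e y v -> e y w -> u != v -> u != w -> v != w ->
  [|| e u v, e u w | e v w].

Definition diamond_free e : Prop :=
  forall x u v w, e x u -> e x v -> e x w -> e u v -> e v w -> u != w -> e u w.

Lemma adj_neq e u v : irreflexive e -> e u v -> u != v.
Proof. by move=> e_irr; apply: contraTneq => ->; rewrite e_irr. Qed.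

Lemma nonadjacent_sym e : symmetric e -> symmetric (nonadjacent e).
Proof. by move=> e_sym u v; rewrite /nonadjacent eq_sym e_sym. Qed.

Lemma nonadjacent_sub e h u v : subrel e h -> nonadjacent h u v -> nonadjacent e u v.
Proof. by move=> eh /andP[uv nuv]; rewrite /nonadjacent uv (contra (eh _ _)). Qed.

Lemma deg_sub e h u : subrel e h -> deg e u <= deg h u.
Proof. by move=> eh; apply/subset_leq_card/subsetP => v; rewrite !inE; apply: eh. Qed.

Lemma heavy_sub e h u : subrel e h -> heavy e u -> heavy h u.
Proof. by move=> eh; rewrite /heavy; have := deg_sub u eh; lia. Qed.

Lemma heavy_pair_sym e : symmetric e -> symmetric (heavy_pair e).
Proof. by move=> e_sym u v; rewrite /heavy_pair eq_sym e_sym addnC. Qed.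

Lemma heavy_deg_add e u v : heavy e u -> heavy e v -> #|T| <= deg e u + deg e v.
Proof. by rewrite /heavy; lia. Qed.

Lemma nonadjacent_heavy_pair e u v :
  nonadjacent e u v -> heavy e u -> heavy e v -> heavy_pair e u v.
Proof. by case/andP=> uv nuv u_heavy v_heavy; rewrite /heavy_pair uv nuv heavy_deg_add. Qed.

Lemma heavy_pair_heavy e u v : heavy_pair e u v -> heavy e u || heavy e v.
Proof. by case/and3P=> _ _; rewrite /heavy; lia. Qed.

Lemma heavy_pair_sub e h u v :
  subrel e h -> heavy_pair e u v -> ~~ h u v -> heavy_pair h u v.
Proof.
move=> eh /and3P[uv _ deg_uv] nuv; rewrite /heavy_pair uv nuv.
exact: leq_trans deg_uv (leq_add (deg_sub u eh) (deg_sub v eh)).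
Qed.

Lemma adj_or_heavy_sym e : symmetric e -> symmetric (adj_or_heavy e).
Proof. by move=> e_sym u v; rewrite /adj_or_heavy e_sym heavy_pair_sym. Qed.

Lemma adj_or_heavy_sub e h u v :
  subrel e h -> adj_or_heavy e u v -> adj_or_heavy h u v.
Proof.
rewrite /adj_or_heavy => eh /orP[/eh ->//|uv].
by case: (boolP (h u v)) => //=; apply: heavy_pair_sub uv.
Qed.

Lemma card_common_nbhd e u v : #|T| <= deg e u + deg e v ->
  #|~: (nbhd e u :|: nbhd e v)| <= #|nbhd e u :&: nbhd e v|.
Proof.
have := cardsUI (nbhd e u) (nbhd e v); have := cardsC (nbhd e u :|: nbhd e v).
by rewrite /deg; lia.
Qed.

Lemma simplicialP e x :
  reflect (forall u v, e x u -> e x v -> u != v -> e u v) (simplicial e x).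
Proof.
apply: (iffP (is_cliqueP _ _)) => simp u v; last by rewrite !inE; apply: simp.
by move=> xu xv; apply: simp; rewrite inE.
Qed.

End Adjacency.

Section LocalCompletion.

Variables (T : finType) (e : rel T) (x : T).
Hypotheses (e_sym : symmetric e) (e_irr : irreflexive e).
Local Notation e' := (local_completion e x).

Lemma local_completion_sym : symmetric e'.
Proof. by move=> u v; rewrite /local_completion /= e_sym eq_sym [e x u && _]andbC. Qed.

Lemma local_completion_irr : irreflexive e'.
Proof. by move=> u; rewrite /local_completion /= e_irr eqxx. Qed.

Lemma sub_local_completion : subrel e e'.
Proof. by move=> u v uv; rewrite /local_completion /= uv. Qed.

Lemma local_completion_nbhd u v : e x u -> e x v -> u != v -> e' u v.
Proof. by move=> xu xv uv; rewrite /local_completion /= uv xu xv orbT. Qed.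

Lemma leq_deg_local_completion u : e x u -> deg e x <= deg e' u.
Proof.
move=> xu; have sub : x |: (nbhd e x :\ u) \subset nbhd e' u.
  apply/subsetP=> v; rewrite !inE => /orP[/eqP->|/andP[vu xv]].
    by apply: sub_local_completion; rewrite e_sym.
  by apply: local_completion_nbhd; rewrite // eq_sym.
apply: leq_trans (subset_leq_card sub).
by rewrite cardsU1 !inE e_irr andbF /deg (cardsD1 u) inE xu.
Qed.

Lemma adj_or_heavy_local_completion u v :
  e x u -> u != v -> adj_or_heavy e x v -> adj_or_heavy e' u v.
Proof.
move=> xu uv; rewrite /adj_or_heavy => /orP[xv|/and3P[_ _ deg_xv]].
  by rewrite local_completion_nbhd.
have [//|nuv] := boolP (e' u v); rewrite /heavy_pair uv nuv /=.
apply: leq_trans deg_xv (leq_add (leq_deg_local_completion xu) _).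
exact/deg_sub/sub_local_completion.
Qed.

Lemma simplicial_local_completion_at : simplicial e' x.
Proof.
have nbhdE u : e' x u = e x u by rewrite /local_completion /= e_irr andbF orbF.
by apply/simplicialP=> u v; rewrite !nbhdE; apply: local_completion_nbhd.
Qed.

Lemma simplicial_local_completion y : simplicial e y -> simplicial e' y.
Proof.
move/simplicialP=> y_simp; apply/simplicialP=> u v yu yv uv.
have [xy|nxy] := boolP (e x y); last first.
  move: yu yv; rewrite /local_completion /= (negbTE nxy) !andbF !orbF => yu yv.
  by rewrite y_simp.
have x_adj z : e' y z -> z != x -> e x z.
  rewrite /local_completion /= => /orP[yz zx|/and3P[]//].
  by apply: y_simp; rewrite // 1?e_sym 1?eq_sym.
have [ux|ux] := eqVneq u x; last have [vx|vx] := eqVneq v x.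
- by rewrite ux sub_local_completion // x_adj // eq_sym -ux.
- by rewrite vx local_completion_sym sub_local_completion // x_adj.
- by apply: local_completion_nbhd; rewrite // x_adj.
Qed.

End LocalCompletion.

Section ClawHeavy.

Variable T : finType.
Implicit Types (e h : rel T) (u v w x y z : T).

Definition claws_heavy e : Prop :=
  forall y u v w, e y u -> e y v -> e y w -> u != v -> u != w -> v != w ->
  [|| adj_or_heavy e u v, adj_or_heavy e u w | adj_or_heavy e v w].

Record claw_heavy_graph e : Prop := ClawHeavyGraph {
  graph_sym : symmetric e;
  graph_irr : irreflexive e;
  graph_claws : claws_heavy e }.

Lemma claw_o_heavy_claws e :
  symmetric e -> irreflexive e -> claw_o_heavy e -> claws_heavy e.
Proof.
move=> e_sym e_irr e_claw y u v w yu yv yw uv uw vw; apply: contraT.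
rewrite !negb_or => /and3P[/andP[euv huv] /andP[euw huw] /andP[evw hvw]].
pose f (k : 'I_4) := nth y [:: y; u; v; w] k.
have f_inj : injective f.
  move=> j k /eqP; rewrite nth_uniq ?ltn_ord //; first by move/eqP/val_inj.
  by rewrite /= !inE !negb_or uv uw vw !(adj_neq e_irr).
have [|p [q [+ + pq]]] := e_claw (f @: [set: 'I_4]).
  have eE := (yu, yv, yw, negbTE euv, negbTE euw, negbTE evw, e_irr,
              e_sym u y, e_sym v y, e_sym w y, e_sym v u, e_sym w u, e_sym w v).
  by exists f; split=> // -[[|[|[|[|j]]]] lj] [[|[|[|[|k]]]] lk] //;
    rewrite /f /= !eE.
have fE z : z \in f @: [set: 'I_4] -> [|| z == y, z == u, z == v | z == w].
  by case/imsetP=> -[[|[|[|[|j]]]] lj] _ ->; rewrite /f //= eqxx ?orbT.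
have hp_sym := heavy_pair_sym e_sym; move: (pq) => /and3P[npq epq _].
have pqE := (eqxx, yu, yv, yw, e_sym u y, e_sym v y, e_sym w y, negbTE huv,
             negbTE huw, negbTE hvw, hp_sym v u, hp_sym w u, hp_sym w v).
by case/fE/or4P=> /eqP pE; subst p; case/fE/or4P=> /eqP qE; subst q;
  move: npq epq pq; rewrite !pqE.
Qed.

(* At most one leaf of an induced claw of the completion is joined to the
   centre [y] by a new edge; replacing that leaf by [x] gives a claw of [e]. *)
Definition old_leaf e x y z : T := if e y z then z else x.

Lemma old_leaf_adj e x y z :
  symmetric e -> local_completion e x y z -> e y (old_leaf e x y z).
Proof.
move=> e_sym; rewrite /old_leaf; case: ifP => // nyz.
by rewrite /local_completion /= nyz e_sym => /and3P[].
Qed.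

Lemma old_leaf_pair e x y z z' : symmetric e -> irreflexive e ->
  local_completion e x y z -> local_completion e x y z' -> z != z' ->
  ~~ adj_or_heavy (local_completion e x) z z' ->
  (old_leaf e x y z != old_leaf e x y z') &&
    ~~ adj_or_heavy e (old_leaf e x y z) (old_leaf e x y z').
Proof.
move=> e_sym e_irr; set e' := local_completion e x => yz yz' zz' far.
have e'_sym : symmetric e' := local_completion_sym x e_sym.
have sub : subrel e e' := @sub_local_completion _ e x.
have new_adj t : e' y t -> ~~ e y t -> e x t.
  by rewrite /e' /= => /orP[->//|/and3P[]].
have replaced t t' : e x t -> t != t' -> ~~ adj_or_heavy e' t t' ->
    (x != t') && ~~ adj_or_heavy e x t'.
  move=> xt tt' tt'_far; rewrite andbC.
  rewrite (contra (adj_or_heavy_local_completion e_sym e_irr xt tt')) //=.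
  by apply: contraNneq tt'_far => <-; rewrite /adj_or_heavy sub // e_sym.
rewrite /old_leaf; have [_|/(new_adj _ yz) xz] := boolP (e y z).
  have [_|/(new_adj _ yz') xz'] := boolP (e y z').
    by rewrite zz' (contra (adj_or_heavy_sub sub)).
  rewrite eq_sym adj_or_heavy_sym //; apply: replaced xz' _ _.
    by rewrite eq_sym.
  by rewrite adj_or_heavy_sym.
have [_|/(new_adj _ yz') xz'] := boolP (e y z'); first exact: replaced xz _ _.
by move: far; rewrite /adj_or_heavy /e' local_completion_nbhd.
Qed.

Lemma local_completion_claws_heavy e x :
  claw_heavy_graph e -> claws_heavy (local_completion e x).
Proof.
case=> e_sym e_irr e_claw y u v w yu yv yw uv uw vw.
apply: contraT => /norP[nuv /norP[nuw nvw]].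
have /andP[uv' nuv'] := old_leaf_pair e_sym e_irr yu yv uv nuv.
have /andP[uw' nuw'] := old_leaf_pair e_sym e_irr yu yw uw nuw.
have /andP[vw' nvw'] := old_leaf_pair e_sym e_irr yv yw vw nvw.
have [yu' yv'] := (old_leaf_adj e_sym yu, old_leaf_adj e_sym yv).
have := e_claw _ _ _ _ yu' yv' (old_leaf_adj e_sym yw) uv' uw' vw'.
by rewrite (negbTE nuv') (negbTE nuw') (negbTE nvw').
Qed.

Lemma local_completion_claw_heavy e x :
  claw_heavy_graph e -> claw_heavy_graph (local_completion e x).
Proof.
move=> e_graph; have [e_sym e_irr _] := e_graph; split.
- exact: local_completion_sym.
- exact: local_completion_irr.
- exact: local_completion_claws_heavy.
Qed.

Lemma reachable_sub e h : c_reachable e h -> subrel e h.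
Proof.
elim=> {e h} [e u v //|e x h _ _ IH u v uv].
by apply: IH; apply: sub_local_completion.
Qed.

Lemma reachable_claw_heavy e h :
  c_reachable e h -> claw_heavy_graph e -> claw_heavy_graph h.
Proof. by elim=> {e h} [e //|e x h _ _ IH /(local_completion_claw_heavy x)]. Qed.

Lemma reachable_simplicial e h x :
  c_reachable e h -> claw_heavy_graph e -> simplicial e x -> simplicial h x.
Proof.
elim=> {e h} [e //|e y h _ _ IH e_graph x_simp].
apply: IH; first exact: local_completion_claw_heavy.
by apply: simplicial_local_completion => //; apply: graph_sym.
Qed.

Lemma reachable_backward h (P : rel T -> Prop) : P h ->
  (forall e x, claw_heavy_graph e -> c_reachable e h -> c_eligible e x ->
     simplicial h x -> P (local_completion e x) -> P e) ->
  forall e, c_reachable e h -> claw_heavy_graph e -> P e.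
Proof.
move=> + + e r; elim: r => {e h} [e //|e x h x_elig r IH] Ph step e_graph.
have e'_graph := local_completion_claw_heavy x e_graph.
apply: step (c_reach_step x_elig r) x_elig _ (IH Ph step e'_graph) => //.
apply: reachable_simplicial r e'_graph _.
exact/simplicial_local_completion_at/graph_irr.
Qed.

End ClawHeavy.

Section StarNeighbourhood.

Variables (T : finType) (h : rel T).
Hypothesis h_graph : claw_heavy_graph h.
Implicit Types u v w x y z : T.
Let h_sym := graph_sym h_graph.
Let h_claws := graph_claws h_graph.

Definition star_connect x : rel T := connect (induced_rel (star h x) (nbhd h x)).

Lemma star_connect_sym x : symmetric (star_connect x).
Proof.
apply: sym_connect_sym; apply: induced_rel_sym => u v.
by rewrite /star /= h_sym heavy_pair_sym // [h x u && _]andbCA.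
Qed.

Lemma adj_or_heavy_star x u v : h x u -> h x v -> adj_or_heavy h u v -> star h x u v.
Proof. by move=> xu xv /orP[]; rewrite /star /= => ->; rewrite ?xu ?xv ?orbT. Qed.

Lemma adj_or_heavy_star_connect x u v :
  h x u -> h x v -> adj_or_heavy h u v -> star_connect x u v.
Proof.
move=> xu xv uv; apply: connect1; rewrite /induced_rel /= !inE xu xv.
exact: adj_or_heavy_star.
Qed.

Lemma star_connect_adj_or_heavy x u v y : h x u -> h x v -> h x y ->
  ~~ star_connect x u y -> star_connect x u v -> u != v -> adj_or_heavy h u v.
Proof.
move=> xu xv xy uy uv nuv.
have vy : ~~ star_connect x v y by apply: contra uy; apply: connect_trans.
have neq w : ~~ star_connect x w y -> w != y.
  by apply: contraNneq => <-; apply: connect0.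
case/or3P: (h_claws xu xv xy nuv (neq u uy) (neq v vy)) => //.
  by move/(adj_or_heavy_star_connect xu xy); rewrite (negbTE uy).
by move/(adj_or_heavy_star_connect xv xy); rewrite (negbTE vy).
Qed.

Lemma star_two_cliques x y1 y2 : h x y1 -> h x y2 -> ~~ star_connect x y1 y2 ->
  two_disjoint_cliques (star h x) (nbhd h x)
    [set y in nbhd h x | star_connect x y1 y]
    [set y in nbhd h x | ~~ star_connect x y1 y].
Proof.
move=> xy1 xy2 y12; split.
- by apply/setP=> y; rewrite !inE -andb_orr orbN andbT.
- by apply/pred0P=> y; rewrite /= !inE; case: (h x y) => //=; apply: andbN.
- apply/is_cliqueP=> u v; rewrite !inE => /andP[xu y1u] /andP[xv y1v] uv.
  apply: adj_or_heavy_star => //; apply: star_connect_adj_or_heavy xu xv xy2 _ _ uv.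
    by apply: contra y12; apply: connect_trans.
  by apply: connect_trans y1v; rewrite -/(star_connect x u y1) star_connect_sym.
- apply/is_cliqueP=> u v; rewrite !inE => /andP[xu y1u] /andP[xv y1v] uv.
  have neq w : ~~ star_connect x y1 w -> y1 != w.
    by apply: contraNneq => <-; apply: connect0.
  case/or3P: (h_claws xy1 xu xv (neq u y1u) (neq v y1v) uv).
  + by move/(adj_or_heavy_star_connect xy1 xu); rewrite (negbTE y1u).
  + by move/(adj_or_heavy_star_connect xy1 xv); rewrite (negbTE y1v).
  + exact: adj_or_heavy_star.
- move=> u v; rewrite !inE => /andP[xu y1u] /andP[xv y1v]; apply: contra y1v => uv.
  by apply: connect_trans y1u (connect1 _); rewrite /induced_rel /= !inE xu xv.
Qed.

Hypothesis h_closed : forall x, ~ c_eligible h x.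

Lemma closed_star_disconnected x u : ~~ simplicial h x -> h x u ->
  exists2 y, h x y & ~~ star_connect x u y.
Proof.
move=> x_nsimp xu; have [y /andP[xy uy]|all_conn] :=
  pickP [pred y | h x y && ~~ star_connect x u y]; first by exists y.
have u_conn y : h x y -> star_connect x u y.
  by move=> xy; have := all_conn y; rewrite /= xy => /negbFE.
case: (h_closed (x := x)); split=> //; left; apply/andP; split.
  by apply/set0Pn; exists u; rewrite inE.
apply/forall_inP=> v; rewrite inE => xv; apply/forall_inP=> w; rewrite inE => xw.
apply: connect_trans (u_conn w xw).
by rewrite -/(star_connect x v u) star_connect_sym u_conn.
Qed.

Lemma closed_star_connect_adj x u v : ~~ simplicial h x -> h x u -> h x v ->
  u != v -> star_connect x u v -> adj_or_heavy h u v.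
Proof.
move=> x_nsimp xu xv nuv uv; have [y xy uy] := closed_star_disconnected x_nsimp xu.
exact: star_connect_adj_or_heavy xu xv xy uy uv nuv.
Qed.

Lemma closed_heavy_pair_star_connect x z y1 y2 : ~~ simplicial h x ->
  heavy_pair h x z -> h x y1 -> h x y2 -> h z y1 -> h z y2 -> star_connect x y1 y2.
Proof.
move=> x_nsimp xz xy1 xy2 zy1 zy2; apply: contraT => y12.
case: (h_closed (x := x)); split=> //; right.
exists [set y in nbhd h x | star_connect x y1 y].
exists [set y in nbhd h x | ~~ star_connect x y1 y].
split; first exact: star_two_cliques xy2 y12.
exists z; split=> //; exists y1, y2; rewrite !inE xy1 xy2 zy1 zy2 y12.
by split=> //; apply: connect0.
Qed.

End StarNeighbourhood.

Section Closed.

Variables (T : finType) (h : rel T).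
Hypotheses (h_graph : claw_heavy_graph h) (h_closed : forall x, ~ c_eligible h x).
Implicit Types u v w x y : T.
Let h_sym := graph_sym h_graph.
Let h_irr := graph_irr h_graph.

Definition star_separated u x y : bool := h x y && ~~ star_connect h x u y.

Lemma heavy_pair_star_separated u v x : heavy_pair h u v -> x \in nbhd h u :&: nbhd h v ->
  exists2 y, y \in ~: (nbhd h u :|: nbhd h v) :\: [set u; v] & star_separated u x y.
Proof.
move=> uv; rewrite !inE ![h _ x]h_sym => /andP[xu xv].
have x_nsimp : ~~ simplicial h x.
  have /and3P[nuv huv _] := uv.
  by apply: contra huv => /simplicialP; apply.
have [y xy uy] := closed_star_disconnected h_graph h_closed x_nsimp xu.
have adj_sep w : star_connect h x u w -> h x w -> ~~ adj_or_heavy h w y.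
  move=> uw xw; apply: contra uy => /(adj_or_heavy_star_connect xw xy).
  exact: connect_trans.
have uv_conn : star_connect h x u v.
  by apply: adj_or_heavy_star_connect; rewrite // /adj_or_heavy uv orbT.
have [nuy _] := norP (adj_sep u (connect0 _ _) xu).
have [nvy _] := norP (adj_sep v uv_conn xv).
exists y; last by rewrite /star_separated xy.
rewrite !inE (negbTE nuy) (negbTE nvy) andbT; apply: contra uy.
by case/orP=> /eqP->; [apply: connect0 | apply: uv_conn].
Qed.

Lemma heavy_pair_star_separated_inj u v x x' y : heavy_pair h u v ->
  x \in nbhd h u :&: nbhd h v -> x' \in nbhd h u :&: nbhd h v ->
  star_separated u x y -> star_separated u x' y -> x = x'.
Proof.
move=> uv; rewrite !inE => /andP[ux vx] /andP[ux' vx'] /andP[xy uy] /andP[x'y _].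
apply/eqP; apply: contraT => nxx'; have [nuv huv _] := and3P uv.
have xu : h x u by rewrite h_sym.
have x_nsimp : ~~ simplicial h x.
  by apply: contra huv => /simplicialP; apply; rewrite // h_sym.
have [xx'|nhxx'] := boolP (h x x').
  case/negP: uy; apply: (@connect_trans _ _ x').
    by apply: adj_or_heavy_star_connect; rewrite // /adj_or_heavy ux'.
  by apply: adj_or_heavy_star_connect; rewrite // /adj_or_heavy x'y.
have u_nsimp : ~~ simplicial h u by apply: contra nhxx' => /simplicialP; apply.
have xx'_conn :=
  closed_heavy_pair_star_connect h_graph h_closed u_nsimp uv ux ux' vx vx'.
have := closed_star_connect_adj h_graph h_closed u_nsimp ux ux' nxx' xx'_conn.
rewrite /adj_or_heavy (negbTE nhxx') /=.
move/(closed_heavy_pair_star_connect h_graph h_closed x_nsimp).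
by move/(_ u y xu xy); rewrite (negbTE uy) h_sym => /(_ ux' x'y).
Qed.

(* A common neighbour [x] of a heavy pair [{u, v}] has a neighbour outside the
   star component of [u], which is a common non-neighbour of [u] and [v];
   distinct [x] get distinct ones, but there are at least two more common
   neighbours than common non-neighbours other than [u] and [v]. *)
Lemma closed_no_heavy_pair u v : ~~ heavy_pair h u v.
Proof.
apply/negP=> uv; have [nuv huv deg_uv] := and3P uv.
set W := nbhd h u :&: nbhd h v; set N := ~: (nbhd h u :|: nbhd h v).
have W_le : #|W| <= #|N :\: [set u; v]|.
  apply: (leq_card_rel (r := star_separated u)) => [x|x x' y xW x'W _].
    exact: heavy_pair_star_separated.
  exact: heavy_pair_star_separated_inj uv xW x'W.
have uvN : [set u; v] \subset N.
  apply/subsetP=> y; rewrite !inE.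
  by case/orP=> /eqP->; rewrite h_irr ?(h_sym v u) (negbTE huv).
have := card_common_nbhd deg_uv; have := cardsID [set u; v] N.
by rewrite (setIidPr uvN) cards2 nuv -/W -/N; lia.
Qed.

Lemma closed_adj_or_heavyE u v : adj_or_heavy h u v = h u v.
Proof. by rewrite /adj_or_heavy (negbTE (closed_no_heavy_pair u v)) orbF. Qed.

Lemma closed_claw_free : claw_free h.
Proof.
move=> y u v w yu yv yw; have := graph_claws h_graph yu yv yw.
by rewrite !closed_adj_or_heavyE.
Qed.

Lemma closed_diamond_free : diamond_free h.
Proof.
move=> x u v w xu xv xw uv vw nuw; apply: contraT => huw.
have x_nsimp : ~~ simplicial h x by apply: contra huw => /simplicialP; apply.
case/negP: huw; rewrite -closed_adj_or_heavyE.
apply: (closed_star_connect_adj h_graph h_closed x_nsimp xu xw nuw).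
by apply: (@connect_trans _ _ v); apply: adj_or_heavy_star_connect;
  rewrite ?closed_adj_or_heavyE.
Qed.

End Closed.

Lemma last_take (T : Type) (c : T) (s : seq T) j :
  j <= size s -> last c (take j s) = nth c (c :: s) j.
Proof.
move=> j_le; rewrite (last_nth c) size_takel //.
by rewrite -[c :: take j s]/(take j.+1 (c :: s)) nth_take.
Qed.

Lemma shortest_path_detour (T : Type) (r : rel T) c (P : pred T) (s : seq T) :
  path r c s -> P (last c s) ->
  (forall p, path r c p -> P (last c p) -> size s <= size p) ->
  forall j l p, j <= size s -> l <= size s -> path r (nth c (c :: s) j) p ->
  last (nth c (c :: s) j) p = nth c (c :: s) l -> l <= j + size p.
Proof.
move=> s_path Ps s_min j l p j_le l_le p_path p_last.
have /andP[drop_path Pdrop] :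
    path r (nth c (c :: s) l) (drop l s) && P (last (nth c (c :: s) l) (drop l s)).
  move: s_path Ps; rewrite -{1 2}(cat_take_drop l s) cat_path last_cat.
  by rewrite last_take // => /andP[_ ->].
have := s_min (take j s ++ p ++ drop l s); rewrite !cat_path !last_cat take_path //.
rewrite last_take // p_path p_last drop_path Pdrop !size_cat size_takel // size_drop.
by move=> /(_ isT isT); lia.
Qed.

Definition insert_at (T : Type) (q : nat -> T) j x l : T :=
  if l <= j then q l else if l == j.+1 then x else q l.-1.

Definition splice (T : Type) (s q : nat -> T) k l : T :=
  if l <= k then s (k - l) else q (l - k).

Section InducedPaths.

Variable T : finType.
Implicit Types (e h r : rel T) (D : {set T}) (q s : nat -> T) (c v x : T) (j k l m n : nat).

Definition induced_path e n q : Prop :=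
  (forall j, j < n -> e (q j) (q j.+1)) /\
  (forall j l, j.+1 < l <= n -> nonadjacent e (q j) (q l)).

Lemma insert_at_induced_path e n q j x : symmetric e -> j < n ->
  (forall l, l < n -> l != j -> e (q l) (q l.+1)) ->
  (forall l m, l.+1 < m <= n -> nonadjacent e (q l) (q m)) ->
  nonadjacent e (q j) (q j.+1) -> e x (q j) -> e x (q j.+1) ->
  (forall l, l <= n -> l != j -> l != j.+1 -> nonadjacent e x (q l)) ->
  induced_path e n (insert_at q j x).
Proof.
move=> e_sym jn consec far gap xj xj1 x_far; rewrite /insert_at.
split=> [l ln|l m /andP[lm mn]].
  have [lj|lj|->] := ltngtP l j; last by rewrite eqxx e_sym.
    by apply: consec; lia.
  case: l ln lj => // l ln lj; rewrite eqSS [_.+2 == _]gtn_eqF //=.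
  by have [->//|lj'] := eqVneq l j; apply: consec; lia.
have [lj|lj] := leqP l j; have [mj|mj] := leqP m j.
- by apply: far; lia.
- have [mj1|mj1] := eqVneq m j.+1; first by rewrite nonadjacent_sym //; apply: x_far; lia.
  have [E|nE] := eqVneq m.-1 l.+1; last by apply: far; lia.
  by rewrite E; have -> : l = j by lia.
- by exfalso; lia.
- rewrite [m == _]gtn_eqF; last by lia.
  by have [lj1|lj1] := eqVneq l j.+1; [apply: x_far | apply: far]; lia.
Qed.

Lemma completed_edge_nbhd e x n q j : symmetric e ->
  induced_path (local_completion e x) n q -> j < n -> ~~ e (q j) (q j.+1) ->
  [/\ nonadjacent e (q j) (q j.+1), e x (q j), e x (q j.+1) &
    forall l, l <= n -> l != j -> l != j.+1 -> nonadjacent e x (q l)].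
Proof.
move=> e_sym [consec far] jn gap; have := consec j jn.
rewrite /local_completion /= (negbTE gap) => /and3P[nq xj xj1].
split=> // [|l ln lj lj1]; first by rewrite /nonadjacent nq.
have x_far z : e x z -> nonadjacent (local_completion e x) z (q l) -> nonadjacent e x (q l).
  move=> xz /andP[zl nzl]; apply/andP; split.
    by apply: contra nzl => /eqP<-; apply: sub_local_completion; rewrite e_sym.
  by apply: contra nzl => xl; apply: local_completion_nbhd.
have e'_sym := local_completion_sym x e_sym.
have [lj'|lj'] := ltnP l j; last by apply: x_far xj _; apply: far; lia.
by apply: x_far xj1 _; rewrite nonadjacent_sym //; apply: far; lia.
Qed.

(* Undoing a completion at [x] destroys at most one edge of an induced path,
   and then [x] can be inserted there. *)
Lemma induced_path_local_completion e x n q : symmetric e ->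
  induced_path (local_completion e x) n q ->
  induced_path e n q \/
  exists j, [/\ j < n, e x (q j.+1) & induced_path e n (insert_at q j x)].
Proof.
move=> e_sym path'; have sub := @sub_local_completion _ e x.
have [consec far] := path'.
have far_e j l : j.+1 < l <= n -> nonadjacent e (q j) (q l).
  by move/far; apply: nonadjacent_sub.
have [/forallP all_old|/forallPn[j new]] := boolP [forall j : 'I_n, e (q j) (q j.+1)].
  by left; split=> // j jn; apply: (all_old (Ordinal jn)).
have [gap xj xj1 x_far] := completed_edge_nbhd e_sym path' (ltn_ord j) new.
right; exists j; split=> //; apply: insert_at_induced_path => // l ln lj.
have := consec l ln; rewrite /local_completion /= => /orP[//|/and3P[_ xl xl1]].
have [lj1|lj1] := eqVneq l j.+1.
  by have /andP[_] : nonadjacent e x (q l.+1) by [apply: x_far; lia]; rewrite xl1.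
by have /andP[_] := x_far l (ltnW ln) lj lj1; rewrite xl.
Qed.

Lemma splice_induced_path e k n s q : symmetric e ->
  induced_path e k s -> induced_path e n q -> s 0 = q 0 ->
  (forall j l, 0 < j <= k -> 0 < l <= n -> nonadjacent e (s j) (q l)) ->
  induced_path e n (splice s q k).
Proof.
move=> e_sym [s_consec s_far] [q_consec q_far] sq0 sq_far; rewrite /splice.
split=> [l ln|l m /andP[lm mn]].
  have [lk|lk|->] := ltngtP l k.
  - rewrite e_sym (_ : k - l = (k - l.+1).+1); last by lia.
    by apply: s_consec; lia.
  - by rewrite subSn ?(ltnW lk) //; apply: q_consec; lia.
  - by rewrite subnn subSnn sq0; apply: q_consec; lia.
have [lk|lk] := leqP l k; have [mk|mk] := leqP m k.
- by rewrite nonadjacent_sym //; apply: s_far; lia.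
- have [kl|kl] := posnP (k - l); first by rewrite kl sq0; apply: q_far; lia.
  by apply: sq_far; lia.
- by exfalso; lia.
- by apply: q_far; lia.
Qed.

Lemma shortest_induced_path r c v (P : pred T) : connect r c v -> P v ->
  exists k q, [/\ q 0 = c, P (q k), induced_path r k q, forall j, j < k -> ~~ P (q j)
    & forall j v, j <= k -> r (q j) v -> P v -> k <= j.+1].
Proof.
case/connectP=> s0 s0_path ->{v} Ps0.
have ex_path : exists n, [exists s : n.-tuple T, path r c s && P (last c s)].
  by exists (size s0); apply/existsP; exists (in_tuple s0); rewrite s0_path.
have [k /existsP[[s /= /eqP s_size] /andP[s_path Ps]] k_min] := ex_minnP ex_path.
have s_min p : path r c p -> P (last c p) -> size s <= size p.
  rewrite s_size => p_path Pp; apply: k_min; apply/existsP.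
  by exists (in_tuple p); rewrite p_path.
have detour := shortest_path_detour s_path Ps s_min.
exists (size s), (nth c (c :: s)); split=> // [||j j_lt|j v j_le jv Pv].
- by rewrite -(last_nth c).
- split=> [|j l /andP[jl l_le]]; first exact: pathP.
  have j_le : j <= size s by lia.
  apply/andP; split.
    by apply/negP=> /eqP/(detour j l [::] j_le l_le isT) /=; lia.
  apply/negP=> rjl.
  by have := detour j l [:: nth c (c :: s) l] j_le l_le; rewrite /= rjl => /(_ isT erefl); lia.
- apply/negP=> Pj; have := s_min (take j s).
  by rewrite take_path // last_take ?size_takel ?(ltnW j_lt) // => /(_ isT Pj); lia.
- have := s_min (rcons (take j s) v); rewrite rcons_path last_rcons.
  by rewrite take_path // last_take // jv Pv size_rcons size_takel //; apply.
Qed.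

Lemma induced_path_within e D k q : q 0 \in D -> induced_path (induced_rel e D) k q ->
  (forall j, j <= k -> q j \in D) /\ induced_path e k q.
Proof.
move=> q0D [consec far]; have qD j : j <= k -> q j \in D.
  by case: j => // j /consec/and3P[].
split=> //; split=> [j /consec/and3P[]//|j l jl].
have /andP[njl] := far j l jl; rewrite /induced_rel /= !qD; [|lia..].
by rewrite /nonadjacent njl.
Qed.

End InducedPaths.

Section InducedEmbedding.

Variables (S T : finType) (s : rel S) (e : rel T) (f : S -> T).
Implicit Types (C P : {set S}).

Definition induced_embedding : Prop :=
  injective f /\ forall a b, e (f a) (f b) = s a b.

Hypothesis f_emb : induced_embedding.
Let f_inj : injective f := proj1 f_emb.
Let f_adj : forall a b, e (f a) (f b) = s a b := proj2 f_emb.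

Lemma max_clique_imset C :
  max_clique_in s [set: S] C -> max_clique_in e (f @: [set: S]) (f @: C).
Proof.
move=> /maxsetP[/andP[_ /is_cliqueP C_clique] C_max]; apply/maxsetP; split.
  rewrite imsetS ?subsetT //; apply/is_cliqueP=> _ _ /imsetP[a aC ->] /imsetP[b bC ->] ab.
  by rewrite f_adj; apply: C_clique => //; apply: contraNneq ab => ->.
move=> D /andP[D_sub /is_cliqueP D_clique] CD.
have <- : f @: (f @^-1: D) = D.
  apply/setP=> v; apply/imsetP/idP => [[a + ->]|vD]; first by rewrite inE.
  by have /imsetP[a _ va] := subsetP D_sub v vD; exists a; rewrite // inE -va.
rewrite [f @^-1: D]C_max //.
  rewrite subsetT; apply/is_cliqueP=> a b; rewrite !inE => aD bD ab.
  by rewrite -f_adj; apply: D_clique => //; rewrite (inj_eq f_inj).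
by apply/subsetP=> a aC; rewrite inE (subsetP CD) ?imset_f.
Qed.

Lemma c_heavy_embedding C P a b : symmetric e -> c_heavy e s ->
  max_clique_in s [set: S] C -> [disjoint P & C] ->
  (forall u v, u \in P -> v \notin C -> s u v -> v \in P) ->
  a \in P -> b \in P -> a != b -> s a b -> exists2 m, m \in P & heavy e (f m).
Proof.
move=> e_sym e_heavy C_max PC P_closed aP bP ab sab.
set D := f @: [set: S] :\: f @: C.
have fP_D u : u \in P -> f u \in D.
  by move=> uP; rewrite in_setD !(mem_imset _ _ f_inj) (disjointFr PC) ?inE.
have fP_closed : closed (induced_rel e D) (f @: P).
  apply: intro_closed; first exact/sym_connect_sym/induced_rel_sym.
  move=> x y xy /imsetP[u uP x_eq]; move: xy.
  rewrite {}x_eq => /and3P[_ /setDP[/imsetP[m _ ->] +] +].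
  by rewrite f_adj !(mem_imset _ _ f_inj) => mC; apply: P_closed.
pose K := [set v in D | connect (induced_rel e D) (f a) v].
have [||| v + v_heavy] := e_heavy _ _ _ (max_clique_imset C_max) K.
- by exists f.
- by exists (f a) => //; apply: fP_D.
- have <- : #|[set f a; f b]| = 2 by rewrite cards2 (inj_eq f_inj) ab.
  apply/subset_leq_card/subsetP=> v /set2P[] ->; rewrite inE fP_D //=.
  by apply: connect1; rewrite /induced_rel /= !fP_D //= f_adj.
rewrite inE => /andP[_ /(closed_connect fP_closed)]; rewrite imset_f //.
by move/esym/imsetP=> [m mP v_eq]; exists m; rewrite // -v_eq.
Qed.

End InducedEmbedding.

Section ZCopies.

Variables (T : finType) (e : rel T) (i : nat).
Hypotheses (e_sym : symmetric e) (e_irr : irreflexive e).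
Implicit Types (a b : T) (q : nat -> T).

Definition induced_Z a b q : Prop :=
  [/\ e a b, e a (q 0), e b (q 0), induced_path e i q
    & forall j, 0 < j <= i -> nonadjacent e a (q j) && nonadjacent e b (q j)].

Lemma induces_copy_Z A : induces_copy e (Z i) A -> exists a b q, induced_Z a b q.
Proof.
case=> [f [f_inj _ f_adj]]; pose g k : T := f (inord k).
have g_adj j k : j < i.+3 -> k < i.+3 -> e (g j) (g k) =
    [|| [&& j != k, j < 3 & k < 3], (2 <= j) && (k == j.+1) | (2 <= k) && (j == k.+1)].
  by move=> ji ki; rewrite /g f_adj /Z /= -val_eqE /= !inordK.
have g_far j k : j < k < i.+3 -> 3 <= k -> (k != j.+1) || (j < 2) ->
    nonadjacent e (g j) (g k).
  move=> /andP[jk ki] k3 kj; apply/andP; split; last by rewrite g_adj; lia.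
  by apply/eqP=> /f_inj/(congr1 val); rewrite /= !inordK; lia.
exists (g 0), (g 1), (fun j => g j.+2); split; try by rewrite g_adj; lia.
  split=> [j ji|j l jl]; first by rewrite g_adj; lia.
  by apply: g_far; lia.
by move=> j ji; rewrite !g_far; lia.
Qed.

Definition Z_vertex a b q k : T :=
  if k is k'.+2 then q k' else if k is 1 then b else a.

Lemma Z_vertex_adj a b q j k : induced_Z a b q -> j < k < i.+3 ->
  if (k < 3) || (2 <= j) && (k == j.+1) then e (Z_vertex a b q j) (Z_vertex a b q k)
  else nonadjacent e (Z_vertex a b q j) (Z_vertex a b q k).
Proof.
move=> [ab aq bq [consec far] off].
case: k => [|[|[|k]]]; case: j => [|[|j]] //= jk.
- by have /andP[] : _ && _ := off k.+1 jk.
- by have /andP[] : _ && _ := off k.+1 jk.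
- case: eqP => [[->]|kj]; first by apply: consec; lia.
  by apply: far; lia.
Qed.

Lemma induced_Z_embedding a b q : induced_Z a b q ->
  induced_embedding (Z i) e (fun k : 'I_(i.+3) => Z_vertex a b q k).
Proof.
move=> Zq; have z_ord (j k : 'I_(i.+3)) : j < k ->
    Z_vertex a b q j != Z_vertex a b q k /\
    e (Z_vertex a b q j) (Z_vertex a b q k) = Z i j k.
  move=> jk; have := @Z_vertex_adj a b q j k Zq; rewrite jk ltn_ord => /(_ isT).
  have -> : Z i j k = (k < 3) || (2 <= j) && (k == j.+1 :> nat).
    by rewrite /Z /= -val_eqE /=; lia.
  by case: ifP => _ => [jk_adj|/andP[-> /negbTE]//]; rewrite (adj_neq e_irr jk_adj).
have Z_sym : symmetric (Z i) by move=> j k; rewrite /Z /= -!val_eqE /=; lia.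
have Z_irr : irreflexive (Z i) by move=> j; rewrite /Z /= -!val_eqE /=; lia.
split=> [j k|j k].
  by case: (ltngtP j k) => [/z_ord[/eqP]|/z_ord[/eqP + _ /esym]|/val_inj].
case: (ltngtP j k) => [/z_ord[]//|/z_ord[_]|/val_inj->]; first by rewrite e_sym Z_sym.
by rewrite e_irr Z_irr.
Qed.

Lemma max_clique_Z : 0 < i ->
  max_clique_in (Z i) [set: 'I_(i.+3)] [set k : 'I_(i.+3) | 1 < k < 4].
Proof.
move=> i_gt0; apply/maxsetP; split.
  rewrite subsetT; apply/is_cliqueP=> j k; rewrite !inE /Z /= -!val_eqE /=; lia.
move=> D /andP[_ /is_cliqueP D_clique] CD; apply/eqP; rewrite eqEsubset CD andbT.
apply/subsetP=> k kD; rewrite inE.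
have D_adj m (mi : m < i.+3) : 1 < m < 4 -> k != Ordinal mi -> Z i k (Ordinal mi).
  by move=> m_C; apply: D_clique => //; apply: (subsetP CD); rewrite inE.
have i2 : 2 < i.+3 by lia.
have i3 : 3 < i.+3 by lia.
have := D_adj 2 i2 isT; have := D_adj 3 i3 isT; rewrite -!val_eqE /Z /=; lia.
Qed.

Lemma c_heavy_Z_part a b q (P : pred nat) j k :
  0 < i -> c_heavy e (Z i) -> induced_Z a b q ->
  (forall m, P m -> ~~ (1 < m < 4)) ->
  (forall m n : 'I_(i.+3), P m -> ~~ (1 < n < 4) -> Z i m n -> P n) ->
  j < k < i.+3 -> P j -> P k -> (k < 3) || (2 <= j) && (k == j.+1) ->
  exists2 m, P m && (m < i.+3) & heavy e (Z_vertex a b q m).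
Proof.
move=> i_gt0 e_heavy /induced_Z_embedding z_emb P_off P_closed /andP[jk ki] Pj Pk jk_adj.
have [||||||m mP] := c_heavy_embedding (P := [set m : 'I_(i.+3) | P m])
  (a := Ordinal (ltn_trans jk ki)) (b := Ordinal ki) z_emb e_sym e_heavy (max_clique_Z i_gt0).
- by rewrite disjoints_subset; apply/subsetP=> m; rewrite !inE; apply: P_off.
- by move=> m n; rewrite !inE; apply: P_closed.
- by rewrite inE.
- by rewrite inE.
- by rewrite -val_eqE /= ltn_eqF.
- by rewrite /Z /= -val_eqE /=; lia.
- by exists m => //; move: mP; rewrite inE ltn_ord andbT.
Qed.

Lemma c_heavy_Z a b q : 3 <= i -> c_heavy e (Z i) -> induced_Z a b q ->
  (exists2 t, t \in [set a; b] & heavy e t) /\ (exists2 j, 1 < j <= i & heavy e (q j)).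
Proof.
move=> i_ge3 e_heavy Zq; have i_gt0 : 0 < i by lia.
split.
  have [||m] :=
    @c_heavy_Z_part a b q (fun m => m < 2) 0 1 i_gt0 e_heavy Zq _ _ isT isT isT isT.
  - by move=> m; lia.
  - by move=> m n; rewrite /Z /= -val_eqE /=; lia.
  case: m => [|[|//]] _ m_heavy; [exists a | exists b] => //;
    by rewrite !inE eqxx ?orbT.
have [|||m] :=
  @c_heavy_Z_part a b q (fun m => 3 < m) 4 5 i_gt0 e_heavy Zq _ _ _ isT isT isT.
- by move=> m; lia.
- by move=> m n; rewrite /Z /= -val_eqE /=; lia.
- by lia.
by case: m => [|[|j]] // j_bound j_heavy; exists j; [lia|].
Qed.

End ZCopies.

Section EdgeClique.

Variables (T : finType) (h : rel T) (a b : T).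
Hypotheses (h_sym : symmetric h) (h_diamond : diamond_free h) (hab : h a b).
Implicit Types u v w o : T.

(* In a diamond-free graph, the unique maximal clique through the edge [ab]. *)
Definition edge_clique : {set T} := [set v | [|| v == a, v == b | h a v && h b v]].

Lemma edge_cliqueP v :
  reflect ((v != a -> h a v) /\ (v != b -> h b v)) (v \in edge_clique).
Proof.
rewrite inE; apply: (iffP or3P) => [[/eqP->|/eqP->|/andP[-> ->]]|[va vb]] //.
- by rewrite eqxx; split=> // _; rewrite h_sym.
- by rewrite eqxx.
- have [->|/va av] := eqVneq v a; first by constructor 1.
  have [->|/vb bv] := eqVneq v b; first by constructor 2.
  by constructor 3; rewrite av bv.
Qed.

Lemma edge_clique_l : a \in edge_clique. Proof. by rewrite inE eqxx. Qed.
Lemma edge_clique_r : b \in edge_clique. Proof. by rewrite inE eqxx orbT. Qed.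

Lemma edge_clique_adj u v : u \in edge_clique -> v \in edge_clique -> u != v -> h u v.
Proof.
move=> /edge_cliqueP[ua ub] /edge_cliqueP[va vb] uv.
have [ua_eq|/ua au] := eqVneq u a; first by rewrite ua_eq va // -ua_eq eq_sym.
have [va_eq|/va av] := eqVneq v a; first by rewrite va_eq h_sym.
have [ub_eq|/ub bu] := eqVneq u b; first by rewrite ub_eq vb // -ub_eq eq_sym.
have [vb_eq|/vb bv] := eqVneq v b; first by rewrite vb_eq h_sym.
by apply: (h_diamond au hab av); rewrite // h_sym.
Qed.

Lemma edge_clique_absorb u v w : u \in edge_clique -> v \in edge_clique -> u != v ->
  h u w -> h v w -> w \in edge_clique.
Proof.
move=> uR vR uv uw vw.
have adj z : z \in edge_clique -> w != z -> h z w.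
  move=> zR wz; have [->//|zu] := eqVneq z u; have [->//|zv] := eqVneq z v.
  by apply: (h_diamond (x := u) (u := z) (v := v)) => //;
    rewrite 1?eq_sym //; apply: edge_clique_adj; rewrite // eq_sym.
by apply/edge_cliqueP; split; apply: adj; rewrite ?edge_clique_l ?edge_clique_r.
Qed.

Lemma edge_clique_attach u v o : o \notin edge_clique ->
  u \in edge_clique -> v \in edge_clique -> h u o -> h v o -> u = v.
Proof.
move=> oR uR vR uo vo; apply/eqP; apply: contraNT oR => uv.
exact: edge_clique_absorb uR vR uv uo vo.
Qed.

Lemma simplicial_edge_clique u w :
  u \in edge_clique -> simplicial h u -> h u w -> w \in edge_clique.
Proof.
move=> uR /simplicialP u_simp uw.
have adj z : z \in edge_clique -> w != z -> h z w.
  move=> zR wz; have [<-//|uz] := eqVneq u z.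
  by apply: u_simp; rewrite // 1?eq_sym // edge_clique_adj.
by apply/edge_cliqueP; split; apply: adj; rewrite ?edge_clique_l ?edge_clique_r.
Qed.

End EdgeClique.

Lemma reachable_nbr (T : finType) (h e : rel T) :
  claw_heavy_graph h -> diamond_free h -> c_reachable e h -> claw_heavy_graph e ->
  forall u o, h u o -> exists2 y, e u y & (y == o) || h y o.
Proof.
move=> h_graph h_diamond; move: e.
have h_sym := graph_sym h_graph.
apply: reachable_backward => [u o uo|e x e_graph r _ x_simp IH u o uo].
  by exists o; rewrite ?eqxx.
have eh := reachable_sub r; have e_sym := graph_sym e_graph.
have [y] := IH u o uo; rewrite /local_completion /= => /orP[uy yo|/and3P[uy xu xy] yo].
  by exists y.
exists x; first by rewrite e_sym.
have [//|nxo] := eqVneq x o; case/orP: yo => [/eqP<-|yo]; first exact: eh.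
have yu : h y u by apply: (simplicialP _ _ x_simp); rewrite 1?eq_sym // eh.
by apply: (h_diamond y x u o); rewrite // 1?(h_sym y x) eh.
Qed.

Section Core.

Variables (T : finType) (h : rel T) (i : nat) (a b : T) (q : nat -> T).
Hypotheses (h_graph : claw_heavy_graph h) (h_closed : forall x, ~ c_eligible h x).
Hypotheses (i_ge3 : 3 <= i) (hZ : induced_Z h i a b q).
Implicit Types (e : rel T) (f o t u v w x y z : T).

Let h_sym := graph_sym h_graph.
Let h_irr := graph_irr h_graph.
Let h_claw := closed_claw_free h_graph h_closed.
Let h_diamond := closed_diamond_free h_graph h_closed.
Let hab : h a b := let: And5 hab _ _ _ _ := hZ in hab.

Local Notation c := (q 0).
Local Notation R := (edge_clique h a b).
Local Notation R_adj := (edge_clique_adj h_sym h_diamond hab).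
Local Notation R_absorb := (edge_clique_absorb h_sym h_diamond hab).
Local Notation R_attach := (edge_clique_attach h_sym h_diamond hab).
Local Notation R_simplicial := (simplicial_edge_clique h_sym h_diamond hab).

(* By diamond-freeness, the vertices of [R] in a second maximal clique. *)
Definition frontier : {set T} := [set v in R | ~~ simplicial h v].
Local Notation F := frontier.

Definition core : {set T} := [set v in R | (v \in [set a; b; c]) || simplicial h v].
Local Notation B := core.

Lemma core_sub : {subset B <= R}.
Proof. by move=> u; rewrite [u \in B]inE => /andP[]. Qed.

Lemma frontier_sub : {subset F <= R}.
Proof. by move=> u; rewrite [u \in F]inE => /andP[]. Qed.

Lemma core_a : a \in B. Proof. by rewrite !inE !eqxx. Qed.
Lemma core_b : b \in B. Proof. by rewrite !inE !eqxx !orbT. Qed.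
Lemma core_c : c \in B.
Proof. by have [_ ac bc _ _] := hZ; rewrite !inE ac bc eqxx !orbT. Qed.

Lemma core_simplicial u : u \in R -> simplicial h u -> u \in B.
Proof. by rewrite [u \in B]inE => -> ->; rewrite orbT. Qed.

Lemma notin_frontier_core u : u \in R -> u \notin F -> u \in B.
Proof. by move=> uR; rewrite inE uR negbK; apply: core_simplicial. Qed.

Lemma notin_core_frontier u : u \in R -> u \notin B -> u \in F.
Proof. by move=> uR; apply: contraR; apply: notin_frontier_core. Qed.

Lemma path_notin_clique j : 0 < j <= i -> q j \notin R.
Proof.
have [_ _ _ _ off] := hZ => /off/andP[/andP[aq naq] /andP[bq _]].
by rewrite inE ![q j == _]eq_sym (negbTE aq) (negbTE bq) (negbTE naq).
Qed.

Lemma frontier_c : c \in F.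
Proof.
rewrite inE (core_sub core_c); have [_ _ _ [consec _] _] := hZ.
apply: contraL (path_notin_clique (j := 1) _) => [c_simp|]; last by lia.
by rewrite negbK (R_simplicial (core_sub core_c) c_simp) // consec; lia.
Qed.

Definition off_core v : Prop := forall u, u \in B -> u != c -> nonadjacent h u v.

Lemma path_off_core j : 0 < j <= i -> off_core (q j).
Proof.
move=> ji u uB uc; have uR := core_sub uB; have qR := path_notin_clique ji.
have [_ _ _ _ /(_ j ji)/andP[aq bq]] := hZ.
move: uB; rewrite [u \in B]inE !inE => /andP[_ /orP[/orP[/orP[]/eqP->//|]|u_simp]].
  by rewrite (negbTE uc).
rewrite /nonadjacent (contraNneq _ qR) => [/=|<-//].
by apply: contra qR; apply: R_simplicial.
Qed.

Lemma core_nonadjacent_q2 u : u \in B -> nonadjacent h u (q 2).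
Proof.
move=> uB; have [->|uc] := eqVneq u c; last by apply: path_off_core => //; lia.
by have [_ _ _ [_ far] _] := hZ; apply: far; lia.
Qed.

Lemma frontier_out f : f \in F -> exists o, [/\ o \notin R, o != q 2 & h f o].
Proof.
have [i1 i3] : 0 < 1 <= i /\ 0 < 3 <= i by lia.
have [_ _ _ [consec far] _] := hZ.
have /andP[q13 nq13] : nonadjacent h (q 1) (q 3) by apply: far.
have h21 : h (q 2) (q 1) by rewrite h_sym; apply: consec; case/andP: i3 => _ /ltnW.
have h23 : h (q 2) (q 3) by apply: consec; case/andP: i3.
rewrite inE => /andP[fR f_nsimp].
have [o oR fo] : exists2 o, o \notin R & h f o.
  apply/exists_inP; apply: contraR f_nsimp; rewrite negb_exists_in => /forall_inP no_out.
  by apply/simplicialP=> u v fu fv; apply: R_adj;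
    apply: contraT => /no_out; rewrite ?fu ?fv.
have [o2|no2] := eqVneq o (q 2); last by exists o.
have f_neq j : 0 < j <= i -> f != q j.
  by move/path_notin_clique; apply: contraNneq => <-.
have h2f : h (q 2) f by rewrite h_sym -o2.
have := h_claw h2f h21 h23 (f_neq 1 i1) (f_neq 3 i3) q13.
rewrite (negbTE nq13) orbF => /orP[fq|fq].
  by exists (q 1); rewrite path_notin_clique // eq_sym (adj_neq h_irr h21).
by exists (q 3); rewrite path_notin_clique // eq_sym (adj_neq h_irr h23).
Qed.

Section Stage.

Variable e : rel T.
Hypotheses (reach : c_reachable e h) (e_graph : claw_heavy_graph e).
Let e_sym := graph_sym e_graph.
Let e_irr := graph_irr e_graph.
Let eh := reachable_sub reach.
Local Notation common u v := (nbhd e u :&: nbhd e v).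
Local Notation avoid u v := (~: (nbhd e u :|: nbhd e v)).

(* Every frontier vertex other than [u] and [v] owns a vertex outside [R] adjacent
   to neither [u] nor [v].  It differs from [q 2], which is a further common
   non-neighbour when [u] and [v] lie in the core. *)
Lemma card_frontier_private u v : u \in R -> v \in R ->
  #|F :\: [set u; v]| <= #|avoid u v :\: (q 2 |: R)|.
Proof.
move=> uR vR; apply: (leq_card_rel (r := h)) => [f|f f' o].
  rewrite in_setD in_set2 negb_or => /andP[/andP[fu fv] fF].
  have [o [oR nq2 fo]] := frontier_out fF; exists o => //; have fR := frontier_sub fF.
  rewrite in_setD in_setU1 (negbTE nq2) oR in_setC in_setU ![o \in nbhd _ _]inE negb_or /=.
  apply/andP; split; [apply: contra fu|apply: contra fv] => /eh xo.
    by rewrite (R_attach oR fR uR fo xo).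
  by rewrite (R_attach oR fR vR fo xo).
move=> /setDP[fF _] /setDP[fF' _]; rewrite in_setD in_setU1 negb_or.
move=> /andP[/andP[_ oR] _] fo f'o.
by apply: R_attach oR _ _ fo f'o; apply: frontier_sub.
Qed.

Lemma card_common_clique u v : u \in R -> v \in R -> u != v ->
  #|T| <= deg e u + deg e v ->
  #|avoid u v :&: (q 2 |: R)| + #|F :\: [set u; v] :\: common u v|
    <= #|common u v :\: F|.
Proof.
move=> uR vR uv deg_uv.
have common_F : #|common u v :&: F| <= #|(F :\: [set u; v]) :&: common u v|.
  apply/subset_leq_card/subsetP=> w; rewrite !in_setI in_setD in_set2 negb_or.
  rewrite ![w \in nbhd _ _]inE => /andP[/andP[uw vw] ->]; rewrite uw vw !andbT.
  by rewrite ![w == _]eq_sym !(adj_neq e_irr).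
have := card_frontier_private uR vR; have := card_common_nbhd deg_uv.
have := cardsID (q 2 |: R) (avoid u v); have := cardsID (common u v) (F :\: [set u; v]).
by have := cardsID F (common u v); lia.
Qed.

Lemma common_core u v w : u \in R -> v \in R -> u != v -> w \in common u v :\: F ->
  [/\ e u w, e v w & w \in B].
Proof.
move=> uR vR uv; rewrite in_setD in_setI ![w \in nbhd _ _]inE => /and3P[wF uw vw].
by split=> //; apply: notin_frontier_core wF; apply: (R_absorb uR vR uv); apply: eh.
Qed.

Lemma core_avoid_q2 u v : u \in B -> v \in B -> q 2 \in avoid u v :&: (q 2 |: R).
Proof.
move=> /core_nonadjacent_q2/(nonadjacent_sub eh)/andP[_ uq].
move=> /core_nonadjacent_q2/(nonadjacent_sub eh)/andP[_ vq].
by rewrite in_setI in_setC in_setU ![q 2 \in nbhd _ _]inE (negbTE uq) (negbTE vq) setU11.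
Qed.

Lemma heavy_pair_avoid u v : u \in R -> v \in R -> heavy_pair e u v ->
  [set u; v] \subset avoid u v :&: (q 2 |: R).
Proof.
move=> uR vR /and3P[_ nuv _]; apply/subsetP=> w /set2P[]->;
  rewrite in_setI in_setC in_setU ![_ \in nbhd _ _]inE e_irr;
  by rewrite ?(e_sym v u) (negbTE nuv) setU1r.
Qed.

Definition in_core_triangle t : bool :=
  (t \in B) && [exists u in B, exists v in B, [&& e t u, e t v & e u v]].

Lemma in_core_triangleI t u v :
  t \in B -> u \in B -> v \in B -> e t u -> e t v -> e u v -> in_core_triangle t.
Proof.
move=> tB uB vB tu tv uv; rewrite /in_core_triangle tB; apply/exists_inP; exists u => //.
by apply/exists_inP; exists v; rewrite // tu tv.
Qed.

Lemma heavy_edge_core_triangle u v : u \in B -> v \in B -> e u v ->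
  heavy e u -> heavy e v -> in_core_triangle u.
Proof.
move=> uB vB uv u_heavy v_heavy; have [uR vR] := (core_sub uB, core_sub vB).
have nuv := adj_neq e_irr uv.
have /card_gt0P[w /(common_core uR vR nuv)[uw vw wB]] : 0 < #|common u v :\: F|.
  apply: leq_trans (leq_trans (leq_addr _ _) (card_common_clique uR vR nuv _)).
    by apply/card_gt0P; exists (q 2); apply: core_avoid_q2.
  exact: heavy_deg_add.
exact: in_core_triangleI uv uw vw.
Qed.

Lemma heavy_pair_core_triangle u v : u \in B -> v \in B -> heavy_pair e u v ->
  heavy e u -> in_core_triangle u.
Proof.
move=> uB vB uv u_heavy; have [uR vR] := (core_sub uB, core_sub vB).
have [nuv _ deg_uv] := and3P uv.
have : 2 < #|common u v :\: F|.
  apply: leq_trans (leq_trans (leq_addr _ _) (card_common_clique uR vR nuv deg_uv)).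
  have /subsetP avoid_uv := heavy_pair_avoid uR vR uv.
  apply/card_gt2P; exists u, v, (q 2); rewrite nuv core_avoid_q2 // !avoid_uv ?set21 ?set22 //.
  have [/andP[uq _] /andP[vq _]] := (core_nonadjacent_q2 uB, core_nonadjacent_q2 vB).
  by rewrite vq eq_sym uq.
case/card_gt2P=> x [y [z [[+ + +] [xy yz]]]]; rewrite eq_sym => + + + xz.
move=> /(common_core uR vR nuv)[ux _ xB] /(common_core uR vR nuv)[uy _ yB].
move=> /(common_core uR vR nuv)[uz _ zB].
have heavy_nbr w : w \in B -> e u w -> heavy e w -> in_core_triangle u.
  by move=> wB uw; apply: heavy_edge_core_triangle uw u_heavy.
have close w w' : w \in B -> w' \in B -> e u w -> e u w' ->
    adj_or_heavy e w w' -> in_core_triangle u.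
  move=> wB w'B uw uw' /orP[ww'|/heavy_pair_heavy/orP[]].
  - exact: in_core_triangleI uw uw' ww'.
  - exact: heavy_nbr.
  - exact: heavy_nbr.
by case/or3P: (graph_claws e_graph ux uy uz xy xz yz); apply: close.
Qed.

Lemma frontier_nbr f : f \in F -> exists2 o, o \notin R & e f o.
Proof.
move=> fF; have [o [oR _ fo]] := frontier_out fF; have fR := frontier_sub fF.
have [y fy yo] := reachable_nbr h_graph h_diamond reach e_graph fo; exists y => //.
case/orP: yo => [/eqP->//|yo]; apply/negP=> yR.
by move: fy; rewrite (R_attach oR fR yR fo yo) e_irr.
Qed.

Lemma frontier_adj_or_heavy f u v : f \in F -> u \in R -> v \in R ->
  e f u -> e f v -> u != v -> adj_or_heavy e u v.
Proof.
move=> fF uR vR fu fv uv; have [o oR fo] := frontier_nbr fF; have fR := frontier_sub fF.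
have o_far w : w \in R -> e f w -> ~~ adj_or_heavy e o w.
  move=> wR fw; apply: contraL fw => /(adj_or_heavy_sub eh).
  rewrite closed_adj_or_heavyE // => ow.
  by rewrite (R_attach oR fR wR (eh fo)) ?e_irr // h_sym.
have o_neq w : w \in R -> o != w by apply: contraTneq => <-.
case/or3P: (graph_claws e_graph fo fu fv (o_neq u uR) (o_neq v vR) uv) => //.
  by rewrite (negbTE (o_far u uR fu)).
by rewrite (negbTE (o_far v vR fv)).
Qed.

Section TriangleFreeCore.

Hypothesis no_triangle : forall t, ~~ in_core_triangle t.

Lemma core_no_heavy_pair u v : u \in B -> v \in B -> ~~ heavy_pair e u v.
Proof.
move=> uB vB; apply/negP=> uv; case/orP: (heavy_pair_heavy uv) => [u_heavy|v_heavy].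
  by have /negP[] := no_triangle u; apply: heavy_pair_core_triangle uv u_heavy.
have /negP[] := no_triangle v; apply: heavy_pair_core_triangle vB uB _ v_heavy.
by rewrite heavy_pair_sym.
Qed.

Lemma frontier_core_nbrs_adj f u v : f \in F -> u \in B -> v \in B ->
  e f u -> e f v -> u != v -> e u v.
Proof.
move=> fF uB vB fu fv uv.
have := frontier_adj_or_heavy fF (core_sub uB) (core_sub vB) fu fv uv.
by rewrite /adj_or_heavy (negbTE (core_no_heavy_pair uB vB)) orbF.
Qed.

Lemma card_frontier_core_nbrs f : f \in F -> #|nbhd e f :&: B| <= 2.
Proof.
move=> fF; rewrite leqNgt; apply/negP.
case/card_gt2P=> x [y [z [[/setIP[+ xB] /setIP[+ yB] /setIP[+ zB]] [xy yz]]]].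
rewrite !in_set eq_sym => fx fy fz xz; have /negP[] := no_triangle x.
have adj := frontier_core_nbrs_adj fF.
by apply: (in_core_triangleI xB yB zB); apply: adj.
Qed.

Lemma frontier_no_heavy_pair u v : u \in R -> u \notin B -> v \in R ->
  ~~ heavy_pair e u v.
Proof.
move=> uR uB vR; apply/negP=> uv; have [nuv _ deg_uv] := and3P uv.
have uF := notin_core_frontier uR uB; have inC := common_core uR vR nuv.
have avoid_ge2 := subset_leq_card (heavy_pair_avoid uR vR uv).
rewrite cards2 nuv in avoid_ge2; have count := card_common_clique uR vR nuv deg_uv.
have common_ge2 := leq_trans avoid_ge2 (leq_trans (leq_addr _ _) count).
have common_sub : common u v :\: F \subset nbhd e u :&: B.
  by apply/subsetP=> w /inC[uw _ wB]; rewrite in_setI wB inE uw.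
have [vB|vB] := boolP (v \in B).
  case/card_gt1P: common_ge2 => x [y [/inC[ux vx xB] /inC[uy vy yB] xy]].
  have /negP[] := no_triangle v; apply: (in_core_triangleI vB xB yB vx vy).
  exact: frontier_core_nbrs_adj uF xB yB ux uy xy.
suff : 2 < #|nbhd e u :&: B| by rewrite ltnNge card_frontier_core_nbrs.
have [uc|nuc] := boolP (e u c).
  have c_sub : c |: (common u v :\: F) \subset nbhd e u :&: B.
    by rewrite subUset sub1set in_setI core_c andbT common_sub andbT inE.
  by apply: leq_trans (subset_leq_card c_sub); rewrite cardsU1 in_setD frontier_c.
apply: leq_trans (subset_leq_card common_sub); apply: leq_trans count.
apply: (leq_add avoid_ge2); apply/card_gt0P; exists c.
rewrite !in_setD in_setI in_set2 negb_or frontier_c.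
rewrite [c \in nbhd e u]inE (negbTE nuc) andbT /=.
by apply/andP; split; [move: uB|move: vB]; apply: contraNneq => <-; apply: core_c.
Qed.

Lemma clique_no_heavy_pair u v : u \in R -> v \in R -> ~~ heavy_pair e u v.
Proof.
move=> uR vR; have [uB|uB] := boolP (u \in B); last exact: frontier_no_heavy_pair.
have [vB|vB] := boolP (v \in B); first exact: core_no_heavy_pair.
by rewrite heavy_pair_sym //; apply: frontier_no_heavy_pair.
Qed.

Lemma eligible_nbhd_connected x u v : c_eligible e x -> simplicial h x -> x \in R ->
  e x u -> e x v -> connect (induced_rel e (nbhd e x)) u v.
Proof.
move=> [_ x_elig] x_simp xR xu xv.
have nbr_R y : h x y -> y \in R := R_simplicial xR x_simp.
case: x_elig => [/andP[_ /forall_inP star_conn]|[C1 [C2 [_ [z [xz _]]]]]].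
  have := star_conn u; rewrite inE => /(_ xu)/forall_inP/(_ v); rewrite inE => /(_ xv).
  apply: connect_sub => y y' /and3P[]; rewrite !inE => xy xy' star_yy'.
  apply: connect1; rewrite /induced_rel /= !inE xy xy'.
  case/orP: star_yy' => // /and3P[_ _]; rewrite (negbTE (clique_no_heavy_pair _ _)) //.
    exact/nbr_R/eh.
  exact/nbr_R/eh.
have hxz : h x z.
  rewrite -(closed_adj_or_heavyE h_graph h_closed) (adj_or_heavy_sub eh) //.
  by rewrite /adj_or_heavy xz orbT.
by case/negP: (clique_no_heavy_pair xR (nbr_R _ hxz)).
Qed.

(* Starting from a core neighbour [u] of [x], the non-core neighbours of [x]
   that are adjacent to [u] absorb everything reachable inside the
   neighbourhood, so another core neighbour is out of reach. *)
Lemma eligible_core_nbr_unique x u v : c_eligible e x -> simplicial h x ->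
  u \in B -> v \in B -> e x u -> e x v -> u = v.
Proof.
move=> x_elig x_simp uB vB xu xv; apply/eqP; apply: contraT => uv.
have xR : x \in R.
  by apply: (R_absorb (core_sub uB) (core_sub vB) uv); rewrite h_sym eh.
have xB := core_simplicial xR x_simp.
have nbr_R y : e x y -> y \in R by move/eh; apply: R_simplicial xR x_simp.
have no_core y : e x y -> e u y -> y \notin B.
  move=> xy uy; apply: contra (no_triangle x) => yB.
  exact: in_core_triangleI xu xy uy.
pose Q := [set y | (y == u) || e u y && (y \notin B)].
have Q_closed : closed (induced_rel e (nbhd e x)) Q.
  apply: intro_closed; first exact/sym_connect_sym/induced_rel_sym.
  move=> y z /and3P[]; rewrite ![_ \in nbhd e x]inE ![_ \in Q]inE => xy xz yz yQ.
  have [//|nzu] := eqVneq z u; suff uz : e u z by rewrite uz no_core.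
  case/orP: yQ => [/eqP<-//|/andP[uy yB]]; have yu : e y u by rewrite e_sym.
  have yF := notin_core_frontier (nbr_R y xy) yB.
  have := frontier_adj_or_heavy yF (core_sub uB) (nbr_R z xz) yu yz.
  by rewrite eq_sym nzu /adj_or_heavy (negbTE (clique_no_heavy_pair _ _)) ?orbF;
    [apply|apply: core_sub|apply: nbr_R].
have := closed_connect Q_closed (eligible_nbhd_connected x_elig x_simp xR xu xv).
by rewrite ![_ \in Q]inE eqxx eq_sym (negbTE uv) vB andbF.
Qed.

End TriangleFreeCore.

End Stage.

Lemma reachable_core_triangle e :
  c_reachable e h -> claw_heavy_graph e -> exists t, in_core_triangle e t.
Proof.
move: e; apply: reachable_backward => [|e x e_graph reach x_elig x_simp [t]].
  have [_ ac bc _ _] := hZ; exists a.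
  exact: in_core_triangleI core_a core_b core_c hab ac bc.
case/andP=> tB /exists_inP[u uB /exists_inP[v vB /and3P[tu tv uv]]].
apply/existsP; apply: contraT => /existsPn no_triangle.
have old_edge y z : y \in B -> z \in B -> local_completion e x y z -> e y z.
  move=> yB zB; rewrite /local_completion /= => /orP[//|/and3P[yz xy xz]].
  have := eligible_core_nbr_unique reach e_graph no_triangle x_elig x_simp yB zB xy xz.
  by move/eqP; rewrite (negbTE yz).
case/negP: (no_triangle t).
by apply: (in_core_triangleI tB uB vB); apply: old_edge.
Qed.

Lemma reachable_core_connect e : c_reachable e h -> claw_heavy_graph e ->
  {in B &, forall u v, connect (induced_rel e B) u v}.
Proof.
move: e; apply: reachable_backward => [u v uB vB|e x e_graph reach _ x_simp IH u v uB vB].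
  have [->|uv] := eqVneq u v; first exact: connect0.
  by apply: connect1; rewrite /induced_rel /= uB vB R_adj ?core_sub.
have eh := reachable_sub reach; have e_sym := graph_sym e_graph.
apply: connect_sub (IH u v uB vB) => y z /and3P[yB zB].
rewrite /local_completion /= => /orP[yz|/and3P[nyz xy xz]].
  by apply: connect1; rewrite /induced_rel /= yB zB.
have xB : x \in B.
  apply: core_simplicial x_simp; apply: (R_absorb (core_sub yB) (core_sub zB) nyz);
    by rewrite h_sym eh.
by apply: (@connect_trans _ _ x); apply: connect1; rewrite /induced_rel /= xB ?yB ?zB // e_sym.
Qed.

Lemma reachable_path_off_core e : c_reachable e h -> claw_heavy_graph e ->
  exists p, [/\ p 0 = c, induced_path e i p & forall j, 0 < j <= i -> off_core (p j)].
Proof.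
move: e; apply: reachable_backward => [|e x e_graph reach _ x_simp [p [p0 p_path p_off]]].
  by exists q; split=> //; [case: hZ | apply: path_off_core].
have eh := reachable_sub reach; have e_sym := graph_sym e_graph.
have [p_path'|[j [ji xj1 p_path']]] := induced_path_local_completion e_sym p_path.
  by exists p.
have pj1_off : off_core (p j.+1) by apply: p_off; lia.
have x_off : off_core x.
  move=> w wB wc; have /andP[wj nwj] := pj1_off w wB wc; apply/andP; split.
    by apply: contraNneq nwj => ->; apply: eh.
  apply: contra nwj => wx; apply: (simplicialP _ _ x_simp) => //; last exact: eh.
  by rewrite h_sym.
exists (insert_at p j x); split=> // l li; rewrite /insert_at.
case: ifP => lj; first exact: p_off.
by case: ifP => lj1 //; apply: p_off; lia.
Qed.

Lemma nearest_core_triangle e : c_reachable e h -> claw_heavy_graph e ->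
  exists k s u v, [/\ s 0 = c, induced_path e k s,
    forall j, j <= k -> s j \in B, forall j, j < k -> ~~ in_core_triangle e (s j)
    & [/\ e u v, e u (s k), e v (s k) & {in [set u; v], forall t,
        [/\ t \in B, t != c & forall j, j < k -> nonadjacent e t (s j)]}]].
Proof.
move=> reach e_graph; have [e_sym e_irr _] := e_graph.
have [t0 t0_tri] := reachable_core_triangle reach e_graph.
have t0B : t0 \in B by case/andP: t0_tri.
have [k [s [s0 sk_tri s_path' s_far s_leave]]] :=
  shortest_induced_path (reachable_core_connect reach e_graph core_c t0B) t0_tri.
have [|sB s_path] := induced_path_within _ s_path'; first by rewrite s0 core_c.
case/andP: (sk_tri) => skB /exists_inP[u uB /exists_inP[v vB /and3P[ku kv uv]]].
exists k, s, u, v; split=> //; split=> // [||t t_uv];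
  [by rewrite e_sym | by rewrite e_sym |].
have [tB kt t_tri] : [/\ t \in B, e (s k) t & in_core_triangle e t].
  case/set2P: t_uv => ->; split=> //.
    by apply: in_core_triangleI uB skB vB _ uv kv; rewrite e_sym.
  by apply: in_core_triangleI vB skB uB _ _ ku; rewrite e_sym.
split=> // [|j jk].
  have [k0|k_gt0] := posnP k; last by apply: contraTneq t_tri => ->; rewrite -s0 s_far.
  by rewrite eq_sym -s0 -[in s 0]k0 (adj_neq e_irr kt).
apply/andP; split; first by apply: contraTneq t_tri => ->; apply: s_far.
apply/negP=> tj; have jt : e (s j) t by rewrite e_sym.
have kj : k = j.+1.
  apply/eqP; rewrite eqn_leq jk andbT; apply: s_leave t_tri; first exact: ltnW.
  by rewrite /induced_rel /= tB sB // ltnW.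
case/negP: (s_far j jk); apply: (in_core_triangleI (sB j (ltnW jk)) tB skB jt).
  by rewrite kj; apply: s_path.1.
by rewrite e_sym.
Qed.

Lemma reachable_induced_Z e : c_reachable e h -> claw_heavy_graph e ->
  exists u v p, [/\ induced_Z e i u v p, {in [set u; v], forall t, t \in B /\ t != c}
    & forall j, 0 < j <= i ->
      (p j \in B) && ~~ in_core_triangle e (p j) \/ off_core (p j)].
Proof.
move=> reach e_graph; have e_sym := graph_sym e_graph; have eh := reachable_sub reach.
have [p [p0 p_path p_off]] := reachable_path_off_core reach e_graph.
have [k [s [u [v [s0 s_path sB s_far [uv uk vk t_far]]]]]] :=
  nearest_core_triangle reach e_graph.
have off_far t w : t \in B -> t != c -> off_core w -> nonadjacent e t w.
  by move=> tB tc /(_ t tB tc); apply: nonadjacent_sub.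
have sc j : 0 < j <= k -> s j != c.
  case/andP; rewrite -s0 eq_sym; case: j => // -[_ k_gt0|j _ jk].
    by have := adj_neq (graph_irr e_graph) (s_path.1 0 k_gt0).
  by have /andP[] := s_path.2 0 j.+2 jk.
exists u, v, (splice s p k); split.
- split=> //; rewrite ?/splice ?subn0 //.
    apply: splice_induced_path => //; first by rewrite s0.
    by move=> j l jk li; apply: off_far; [apply: sB; case/andP: jk|apply: sc|apply: p_off].
  move=> j ji; have t_off t : t \in [set u; v] -> nonadjacent e t (splice s p k j).
    case/t_far=> tB tc t_s; rewrite /splice; case: leqP => jk; first by apply: t_s; lia.
    by apply: off_far => //; apply: p_off; lia.
  by rewrite -/(splice s p k j) !t_off ?set21 ?set22.
- by move=> t /t_far[].
move=> j ji; rewrite /splice; case: leqP => jk; last by right; apply: p_off; lia.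
by left; rewrite sB ?s_far; lia.
Qed.

Lemma closure_Z_not_c_heavy e :
  c_reachable e h -> claw_heavy_graph e -> ~ c_heavy e (Z i).
Proof.
move=> reach e_graph e_heavy; have [e_sym e_irr _] := e_graph.
have [u [v [p [e_Z t_core p_core]]]] := reachable_induced_Z reach e_graph.
have [[t t_uv t_heavy] [j j_bound pj_heavy]] := c_heavy_Z e_sym e_irr i_ge3 e_heavy e_Z.
have [tB tc] := t_core t t_uv; have ji : 0 < j <= i by lia.
have t_pj : nonadjacent e t (p j).
  by have [_ _ _ _ /(_ j ji)/andP[]] := e_Z; case/set2P: t_uv => ->.
case: (p_core j ji) => [/andP[pjB /negP[]]|pj_off].
  apply: (heavy_pair_core_triangle reach e_graph pjB tB _ pj_heavy).
  by apply: nonadjacent_heavy_pair; rewrite // nonadjacent_sym.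
have := closed_no_heavy_pair h_graph h_closed t (p j); have eh := reachable_sub reach.
by rewrite nonadjacent_heavy_pair ?(heavy_sub eh) //; apply: pj_off.
Qed.

End Core.

Theorem theorem14 (T : finType) (e : rel T)
    (e_sym : symmetric e) (e_irr : irreflexive e)
    (i : nat) (i_ge3 : 3 <= i)
    (e_claw : claw_o_heavy e) (e_Z : c_heavy e (Z i))
    (h : rel T) (h_cl : is_c_closure e h) :
  graph_free h (Z i).
Proof.
have [reach h_closed] := h_cl.
have e_graph : claw_heavy_graph e by split=> //; apply: claw_o_heavy_claws.
have h_graph := reachable_claw_heavy reach e_graph.
case=> A /induces_copy_Z[a [b [q hZ]]].
exact: (closure_Z_not_c_heavy h_graph h_closed i_ge3 hZ reach e_graph e_Z).
Qed.
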